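(* Let $\theta$ be a $B$-action on $[0,\infty)\times[0,\infty)$ and let $(X,d,\theta)$ be a $\theta$-metric space. Then $X$, equipped with the natural topology induced by $d$, is metrizable, i.e. there exists a metric on $X$ whose metric topology coincides with the topology induced by $d$.
   Context: $B$-action: Let $\theta:[0,\infty)\times[0,\infty)\to[0,\infty)$ be a mapping that is continuous with respect to each variable separately, and let $\mathrm{Im}(\theta)=\{\theta(s,t): s,t\ge 0\}$. Then $\theta$ is called a $B$-action if: (i) $\theta(0,0)=0$ and $\theta(s,t)=\theta(t,s)$ for all $s,t\ge 0$; (ii) $\theta(x,y)<\theta(s,t)$ whenever either $x\le s,\ y<t$ or $x<s,\ y\le t$; (iii) for each $m\in \mathrm{Im}(\theta)$ and each $t\in[0,m]$ there exists $s\in[0,m]$ such that $\theta(s,t)=m$; (iv) $\theta(s,0)\le s$ for all $s>0$. $\theta$-metric space: Let $X$ be a non-empty set and $\theta$ a $B$-action. A function $d:X\times X\to[0,\infty)$ is a $\theta$-metric on $X$ with respect to $\theta$, and $(X,d,\theta)$ is called a $\theta$-metric space, if: (i) for all $x,y\in X$, $d(x,y)=0$ if and only if $x=y$; (ii) $d(x,y)=d(y,x)$ for all $x,y\in X$; (iii) $d(x,z)\le\theta(d(x,y),d(y,z))$ for all $x,y,z\in X$. Natural topology induced by $d$ (defined as for metric spaces): a set $U\subseteq X$ is open if and only if for every $x\in U$ there is $\varepsilon>0$ such that $\{y\in X: d(x,y)<\varepsilon\}\subseteq U$. *)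

(* Defs.v *)
From HB Require Import structures.
From mathcomp Require Import all_boot all_order all_algebra.
From mathcomp Require Import all_classical all_reals all_analysis.

Set Implicit Arguments.
Unset Strict Implicit.
Unset Printing Implicit Defensive.

Import Order.TTheory GRing.Theory Num.Theory.
Import numFieldNormedType.Exports.

Local Open Scope classical_set_scope.
Local Open Scope ring_scope.

(* A map [0, oo) x [0, oo) -> [0, oo) is represented by a total function
   theta : R -> R -> R of which only the values at nonnegative arguments are
   ever constrained or used. *)
Definition theta_image (R : realType) (theta : R -> R -> R) : set R :=
  [set theta s t | s in `[0, +oo[ & t in `[0, +oo[].

Record B_action (R : realType) (theta : R -> R -> R) : Prop := {
  B_action_ge0 : forall s t, 0 <= s -> 0 <= t -> 0 <= theta s t;
  B_action_continuousl : forall t, 0 <= t ->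
    {within `[0, +oo[, continuous (fun s => theta s t)};
  B_action_continuousr : forall s, 0 <= s ->
    {within `[0, +oo[, continuous (fun t => theta s t)};
  B_action00 : theta 0 0 = 0;
  B_actionC : forall s t, 0 <= s -> 0 <= t -> theta s t = theta t s;
  B_action_lt : forall x y s t, 0 <= x -> 0 <= y -> 0 <= s -> 0 <= t ->
    (x <= s /\ y < t) \/ (x < s /\ y <= t) -> theta x y < theta s t;
  B_action_solve : forall m t, theta_image theta m -> 0 <= t <= m ->
    exists2 s, 0 <= s <= m & theta s t = m;
  B_action_le : forall s, 0 < s -> theta s 0 <= s
}.

Record theta_metric (R : realType) (X : Type) (theta : R -> R -> R)
    (d : X -> X -> R) : Prop := {
  theta_metric_ge0 : forall x y, 0 <= d x y;
  theta_metric_eq0 : forall x y, d x y = 0 <-> x = y;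
  theta_metricC : forall x y, d x y = d y x;
  theta_metric_triangle : forall x y z, d x z <= theta (d x y) (d y z)
}.

Definition dist_open (R : realType) (X : Type) (d : X -> X -> R) : set (set X) :=
  [set U | forall x, U x -> exists2 e, 0 < e & [set y | d x y < e] `<=` U].

(* The set X with the natural topology induced by d. The family dist_open d is
   a topology for an arbitrary function d, so no axiom on d is needed here. *)
Definition dist_space (R : realType) (X : Type) (d : X -> X -> R) : Type := X.

Section dist_space_topology.
Context (R : realType) (X : Type) (d : X -> X -> R).

HB.instance Definition _ := gen_eqMixin (dist_space d).
HB.instance Definition _ := gen_choiceMixin (dist_space d).

Let dist_openT : dist_open d setT.
Proof. by move=> x _; exists 1. Qed.

Let dist_openI : setI_closed (dist_open d).
Proof.
move=> U V oU oV x [/oU[e e0 eU] /oV[f f0 fV]].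
exists (Num.min e f); first by rewrite lt_min e0 f0.
by move=> y /=; rewrite lt_min => /andP[ye yf]; split; [exact: eU|exact: fV].
Qed.

Let dist_open_bigU (I : Type) (f : I -> set X) :
  (forall i, dist_open d (f i)) -> dist_open d (\bigcup_i f i).
Proof.
move=> of_ x [i _ /of_[e e0 ef]]; exists e => // y /ef fy.
by exists i.
Qed.

HB.instance Definition _ := isOpenTopological.Build (dist_space d)
  dist_openT dist_openI dist_open_bigU.

Lemma dist_space_openE : @open (dist_space d) = dist_open d.
Proof. by []. Qed.

End dist_space_topology.

(* M is a metric structure, in the sense of metricType, carried by T itself;
   metrizableP below restates this in terms of a distance function. *)
Definition metrizable (R : realType) (T : topologicalType) : Prop :=
  exists M : Metric.axioms_ R T, @open (Metric.Pack M) = @open T.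

Section metric_of_dist.
Context (R : realType) (T : choiceType) (rho : T -> T -> R).
Hypothesis rho_eq0 : forall x y, rho x y = 0 <-> x = y.
Hypothesis rhoC : forall x y, rho x y = rho y x.
Hypothesis rho_triangle : forall x y z, rho x z <= rho x y + rho y z.

Definition dist_metricType : Type := T.

HB.instance Definition _ := Choice.on dist_metricType.

Let rhoxx x : rho x x = 0. Proof. exact/rho_eq0. Qed.

Let rho_positivity x y : rho x y = 0 -> x = y. Proof. by move/rho_eq0. Qed.

HB.instance Definition _ := @isMetric.Build R dist_metricType rho
  rhoxx rho_positivity rhoC (fun y x z => rho_triangle x y z).

Definition metric_axioms_of_dist : Metric.axioms_ R T :=
  Metric.class dist_metricType.

End metric_of_dist.

Lemma metric_openE (R : realType) (T : metricType R) :
  @open T = dist_open (@mdist R T).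
Proof.
apply/seteqP; split => U; rewrite openE /=.
  move=> oU x /oU; rewrite /interior.
  by rewrite -metricType_numDomainType.filter_from_mdist_nbhs => -[e e0 eU]; exists e.
move=> oU x /oU [e e0 eU]; rewrite /interior.
by rewrite -metricType_numDomainType.filter_from_mdist_nbhs; exists e.
Qed.

Lemma metrizableP (R : realType) (T : topologicalType) :
  metrizable R T <-> exists rho : T -> T -> R,
    [/\ forall x y, rho x y = 0 <-> x = y,
        forall x y, rho x y = rho y x,
        forall x y z, rho x z <= rho x y + rho y z &
        @open T = dist_open rho].
Proof.
split=> [[M MT]|[rho [rho0 rhoC rhoD rhoT]]].
  pose X := Metric.Pack M; exists (@mdist R X); split.
  - by move=> x y; split=> [/(@mdist_positivity R X)//|->]; exact: (@mdistxx R X).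
  - exact: (@metric_sym R X).
  - exact: (@metric_triangle R X).
  - by rewrite -MT (@metric_openE R X).
exists (metric_axioms_of_dist rho0 rhoC rhoD).
by rewrite rhoT (@metric_openE R (Metric.Pack (metric_axioms_of_dist rho0 rhoC rhoD))).
Qed.

(* Main.v *)
Require Import Defs.
From HB Require Import structures.
From mathcomp Require Import all_boot all_order all_algebra.
From mathcomp Require Import all_classical all_reals all_analysis.
From mathcomp Require Import lra.

(** The values of a B-action near the origin are small, so the triangle
inequality makes the sets [{(x, y) | d x y < e}], for [e > 0], a base of a
uniformity. This uniformity has a countable base, given by [e = 1 / (n + 1)],
and is separated, hence it comes from a metric. *)

Import Order.TTheory GRing.Theory Num.Theory.
Import numFieldNormedType.Exports.

Local Open Scope classical_set_scope.
Local Open Scope ring_scope.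

(** A countable base makes the uniformity pseudometric. The metric is the infimum [edist] of the
    radii of balls around [x] containing [y]: points at distance zero are close, hence equal in a
    Hausdorff space. *)
Lemma countable_uniformity_metrizable (R : realType) (T : uniformType) :
  countable_uniformity T -> hausdorff_space T -> metrizable R T.
Proof.
move=> ctbT hT; pose M : pseudoMetricType R := @countable_uniform.type T ctbT.
(* Any two points of [M] lie in a common ball of radius 2, so [fine] loses nothing. *)
have dfin (x y : M) : edist (x, y) \is a fin_num.
  by apply/edist_finP; exists 2 => //;
     exact: countable_uniform.countable_uniform_bounded.
apply/metrizableP; exists (fun x y : T => fine (edist (x : M, y : M))); split.
- move=> x y; split=> [d0|->]; last by rewrite edist_refl.
  apply: (close_eq hT); apply: (proj2 (@edist_closeP R M x y)).
  by rewrite -[LHS]fineK// d0.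
- by move=> x y; rewrite edist_sym.
- move=> x y z; rewrite -fineD// fine_le ?fin_numD ?dfin//.
  exact: edist_triangle.
- apply/funext => U; rewrite openE; apply/propext; split.
  + move=> oU x /oU; rewrite /interior -(@nbhs_ballE R M) => -[e e0 eU].
    exists e => // y /= xye; apply: eU; apply: (@edist_lt_ball R M e (x, y)).
    by rewrite -[X in (X < _)%E]fineK// lte_fin.
  + move=> oU x /oU[e e0 eU]; rewrite /interior -(@nbhs_ballE R M).
    (* Lying in a ball bounds [edist] by its radius only weakly; halving restores strictness. *)
    exists (e / 2); first exact: divr_gt0.
    move=> y xy; apply: eU => /=.
    rewrite -lte_fin fineK//.
    apply: le_lt_trans (@edist_fin R M (e / 2) (x, y) _ xy) _.
      exact: divr_gt0.
    by rewrite lte_fin; lra.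
Qed.

Section uniform_dist.
Context (R : realType) (X : Type) (d : X -> X -> R).
Hypothesis d_eq0 : forall x y, d x y = 0 <-> x = y.
Hypothesis d_ge0 : forall x y, 0 <= d x y.
Hypothesis dC : forall x y, d x y = d y x.
(** This uniform substitute for the triangle inequality is what splits entourages. *)
Hypothesis d_small : forall e : R, 0 < e -> exists2 r, 0 < r &
  forall x y z, d x y < r -> d y z < r -> d x z < e.

(** A separate name keeps the topology generated by the entourages apart from the one already on
    [dist_space d]; [open_U] identifies them. *)
Let U : Type := dist_space d.
Let ent : set_system (U * U) := entourage_ (fun x e => [set y | d x y < e]).

Let ent_filter : Filter ent.
Proof.
apply: filter_from_filter; first by exists 1 => /=.
move=> e f /= e0 f0; exists (Num.min e f); first by rewrite /= lt_min e0 f0.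
by move=> [x y] /=; rewrite lt_min => /andP.
Qed.

Let ent_refl A : ent A -> diagonal `<=` A.
Proof.
by case=> e /= e0 eA [x y] /diagonalP ->; apply: eA => /=; rewrite (d_eq0 y y).2.
Qed.

Let ent_inv A : ent A -> ent A^-1%relation.
Proof.
by case=> e /= e0 eA; exists e => // -[x y] /=; rewrite dC => /(eA (y, x)).
Qed.

Let ent_split A : ent A -> exists2 B, ent B & (B \; B `<=` A)%relation.
Proof.
case=> e /= e0 eA; have [r r0 rd] := d_small _ e0.
exists [set xy | d xy.1 xy.2 < r]; first by exists r.
by move=> [x z] [y /= xy yz]; apply: eA; exact: rd xy yz.
Qed.

HB.instance Definition _ := Choice.on U.
HB.instance Definition _ :=
  @isUniform.Build U ent ent_filter ent_refl ent_inv ent_split.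

Let nbhs_U (x : U) :
  nbhs x = filter_from [set e | 0 < e] (fun e => [set y | d x y < e]).
Proof.
rewrite -nbhs_entourageE; apply/funext => A; apply/propext; split.
  move=> [B [e e0 eB] BA]; exists e => // y xy; apply: BA.
  by apply/xsectionP/eB.
move=> [e e0 eA]; exists [set xy | d xy.1 xy.2 < e]; first by exists e.
by move=> y /xsectionP /eA.
Qed.

Let open_U : @open U = dist_open d.
Proof.
by apply/funext => A; rewrite openE; apply/propext; split=> oA x /oA;
  rewrite /interior nbhs_U.
Qed.

(** For [e = d x y > 0], a point common to the [r]-balls around [x] and [y] would give
    [d x y < d x y]. *)
Let hausdorff_U : hausdorff_space U.
Proof.
move=> x y cxy; apply/(d_eq0 x y)/le_anti; rewrite d_ge0 andbT leNgt.
apply/negP => xy0; have [r r0 rd] := d_small _ xy0.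
have nbhsr (z : U) : nbhs z [set t | d z t < r] by rewrite nbhs_U; exists r.
have [z [/= xz yz]] := cxy _ _ (nbhsr x) (nbhsr y).
by rewrite dC in yz; have := rd _ _ _ xz yz; rewrite ltxx.
Qed.

Let countable_U : countable_uniformity U.
Proof.
apply/countable_uniformityP.
exists (fun n => [set xy | d xy.1 xy.2 < n.+1%:R^-1]); last first.
  by move=> n; exists n.+1%:R^-1 => //=; rewrite invr_gt0.
(* With [n] the integer part of [1 / e], [n + 1 > 1 / e]. *)
move=> A [e /= e0 eA]; exists (Num.truncn e^-1) => xy /= h; apply: eA => /=.
apply: lt_trans h _; rewrite -[ltRHS]invrK ltf_pV2 ?posrE ?invr_gt0//.
exact: truncnS_gt.
Qed.

Lemma uniform_dist_metrizable : metrizable R (dist_space d).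
Proof.
have /metrizableP[rho [rho0 rhoC rhoD oU]] :=
  countable_uniformity_metrizable R U countable_U hausdorff_U.
by apply/metrizableP; exists rho; split=> //; rewrite -oU open_U.
Qed.

End uniform_dist.

(** Since [theta (e / 2) 0 <= e / 2 < e], continuity in the second variable keeps [theta (e / 2) t]
    below [e] for some [t > 0]; monotonicity extends the bound to all smaller arguments. *)
Lemma B_action_small (R : realType) (theta : R -> R -> R) (e : R) :
  B_action theta -> 0 < e -> exists2 r, 0 < r &
    forall s t, 0 <= s < r -> 0 <= t < r -> theta s t < e.
Proof.
move=> th e0; have s0 : 0 < e / 2 by lra.
have := B_action_continuousr th (ltW s0).
move=> /continuous_within_itvcyP[_ /cvgr_lt /(_ e)].
have -> : theta (e / 2) 0 < e by have := B_action_le th s0; lra.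
move=> /(_ isT); rewrite /at_right/= near_withinE.
move=> /nbhs_ballP[r /= r0 rth].
(* The corner [(e / 2, r / 2)] dominates the box, and [r / 2] lies inside the open ball of radius
   [r] at 0. *)
exists (Num.min (e / 2) (r / 2)); first by rewrite lt_min s0 divr_gt0.
move=> s t /andP[s_ge0]; rewrite !lt_min => /andP[se _] /andP[t_ge0 /andP[_ tr]].
have /rth : ball 0 r (r / 2) by rewrite /ball /= sub0r normrN gtr0_norm; lra.
move=> /(_ ltac:(lra)); apply: lt_trans.
by apply: (B_action_lt th); [lra..|left; split; lra].
Qed.

Theorem theorem2p5 (R : realType) (X : Type) (theta : R -> R -> R)
    (d : X -> X -> R) (X_nonempty : inhabited X)
    (theta_B_action : B_action theta) (d_theta_metric : theta_metric theta d) :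
  metrizable R (dist_space d).
Proof.
have [d_ge0 d_eq0 dC dD] := d_theta_metric.
(* What remains is [d_small], obtained by bounding [theta (d x y) (d y z)] for small distances. *)
apply: uniform_dist_metrizable => // e e0.
have [r r0 rth] := B_action_small R theta e theta_B_action e0.
exists r => // x y z xy yz; apply: le_lt_trans (dD x y z) _.
by apply: rth; rewrite d_ge0.
Qed.
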